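(* Let $f=\frac1n\sum_{i=1}^n f_i$ where each $f_i:\mathbb{R}^d\to\mathbb{R}$ is convex and $L_i$-smooth, assume that $f$ is $\mu$-strongly convex ($\mu>0$) with minimizer $x^*$, and let $L_{\max}=\max_{1\le i\le n}L_i$. Assume interpolation, i.e. $\sigma=0$. Then the iterates of SGD with SPS with $c=1/2$ satisfy, for all $k\ge0$, $$\mathbb{E}\|x^{k}-x^*\|^2\le\left(1-\frac{\mu}{L_{\max}}\right)^k\|x^0-x^*\|^2.$$
   Context: Setting: $f(x)=\frac1n\sum_{i=1}^n f_i(x)$ is minimized over $\mathbb{R}^d$, and the set $\mathcal{X}^*$ of minimizers of $f$ is nonempty. A function is $L$-smooth if it is differentiable with $L$-Lipschitz gradient. For each $i$, $f_i^*:=\inf_x f_i(x)$, and it is assumed throughout that $\sigma^2:=\mathbb{E}_i[f_i(x^* )-f_i^*]=f(x^* )-\frac1n\sum_{i=1}^n f_i^*<\infty$ (so all $f_i^*$ are finite), where $x^*\in\mathcal{X}^*$. SGD: starting from a deterministic $x^0$, at each iteration $k$ an index $i\in\{1,\dots,n\}$ is drawn uniformly at random, independently of the past, and $x^{k+1}=x^k-\gamma_k\nabla f_i(x^k)$. SPS with parameter $c>0$: $\gamma_k=\frac{f_i(x^k)-f_i^*}{c\|\nabla f_i(x^k)\|^2}$, where $i$ is the index drawn at iteration $k$ (no upper bound is imposed on the step-size). If $\nabla f_i(x^k)=0$ then $x^{k+1}=x^k$. *)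

(* Defs.v *)
From HB Require Import structures.
From mathcomp Require Import all_boot all_order all_algebra finmap.
From mathcomp Require Import all_classical all_reals all_analysis.

Set Implicit Arguments.
Unset Strict Implicit.
Unset Printing Implicit Defensive.

Import Order.TTheory GRing.Theory Num.Theory.
Import numFieldNormedType.Exports.

Local Open Scope classical_set_scope.
Local Open Scope ring_scope.

Section Euclidean.
Context {R : realType} {d : nat}.
Implicit Types (u v x y : 'rV[R]_d) (g : 'rV[R]_d -> R).

(* The library norm `|u| on 'rV[R]_d is the sup norm. It induces the same
   topology, hence the same notion of differentiability, but the Lipschitz
   constants, the step-sizes and the rate refer to the Euclidean norm. *)
Definition enorm u : R := Num.sqrt (\sum_(j < d) u 0 j ^+ 2).

Definition grad g x : 'rV[R]_d := \row_(j < d) 'D_(delta_mx 0 j) g x.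

Definition smooth (L : R) g : Prop :=
  (forall x, differentiable g x) /\
  (forall x y, enorm (grad g x - grad g y) <= L * enorm (x - y)).

Definition convex g : Prop := convex_function [set: 'rV[R]_d] g.

Definition strongly_convex (mu : R) g : Prop :=
  forall (t : R) x y, 0 <= t <= 1 ->
    g (t *: x + (1 - t) *: y) <=
    t * g x + (1 - t) * g y - mu / 2 * t * (1 - t) * enorm (x - y) ^+ 2.

Definition minimizer g x : Prop := forall y, g x <= g y.

End Euclidean.

Section SGD.
Context {R : realType} {d : nat}.

(* The library's real-valued [inf] is the infimum only for sets that are
   bounded below: the statement assumes [bounded_below] for every component. *)
Definition bounded_below (g : 'rV[R]_d -> R) : Prop := has_lbound (range g).
Definition infimum (g : 'rV[R]_d -> R) : R := inf (range g).

(* Components are indexed by 'I_n.+1, so that there is at least one of them. *)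
Definition average {n} (f : 'I_n.+1 -> 'rV[R]_d -> R) (x : 'rV[R]_d) : R :=
  n.+1%:R^-1 * \sum_(i < n.+1) f i x.

Definition sigma2 {n} (f : 'I_n.+1 -> 'rV[R]_d -> R) (xs : 'rV[R]_d) : R :=
  average f xs - n.+1%:R^-1 * \sum_(i < n.+1) infimum (f i).

Definition maxL {n} (L : 'I_n.+1 -> R) : R :=
  \big[Num.max/L ord0]_(i < n.+1) L i.

(* As division by zero gives zero, the step-size vanishes where the gradient
   does. *)
Definition sps_stepsize (c : R) (g : 'rV[R]_d -> R) (x : 'rV[R]_d) : R :=
  (g x - infimum g) / (c * enorm (grad g x) ^+ 2).

Fixpoint sgd_sps {n} (c : R) (f : 'I_n.+1 -> 'rV[R]_d -> R) (x0 : 'rV[R]_d)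
    (idx : nat -> 'I_n.+1) (k : nat) : 'rV[R]_d :=
  match k with
  | 0%N => x0
  | k'.+1 =>
      let x := sgd_sps c f x0 idx k' in
      let g := f (idx k') in
      x - sps_stepsize c g x *: grad g x
  end.

End SGD.

Section Sampling.
Context {R : realType} {disp : measure_display} {T : measurableType disp}.

Definition mutually_independent {I : finType} (P : probability T R)
    (X : nat -> T -> I) : Prop :=
  forall (J : {fset nat}) (A : nat -> set I),
    (P (\bigcap_(k in [set` J]) (X k @^-1` A k)) =
     \prod_(k <- J) P (X k @^-1` A k))%E.

(* The finite index set carries the discrete sigma-algebra. *)
Definition iid_uniform {n} (P : probability T R)
    (idx : nat -> T -> 'I_n.+1) : Prop :=
  [/\ forall k (A : set 'I_n.+1), measurable (idx k @^-1` A),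
      forall k (i : 'I_n.+1),
        P (idx k @^-1` [set i]) = (n.+1%:R^-1 : R)%:E
    & mutually_independent P idx].

End Sampling.

(* Main.v *)
Require Import Defs.
From HB Require Import structures.
From mathcomp Require Import all_boot all_order all_algebra finmap.
From mathcomp Require Import all_classical all_reals all_analysis.
From mathcomp Require Import measurable_realfun.
From mathcomp Require Import ring lra.

Set Implicit Arguments.
Unset Strict Implicit.
Unset Printing Implicit Defensive.

Import Order.TTheory GRing.Theory Num.Theory.
Import numFieldNormedType.Exports.

Local Open Scope classical_set_scope.
Local Open Scope ring_scope.

(** Write [V x] for the squared distance [enorm (x - xs) ^+ 2], and let [g] be
    a component, [G] its gradient at [x] and [gam] the Polyak step-size with
    [c = 1/2]. Interpolation means that every component attains its infimum at
    [xs], so [gam * |G|^2 = 2 (g x - g xs)], and expanding the square gives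
      V (x - gam G) = V x - 2 gam B,   B = <G, x - xs> - (g x - g xs).
    Convexity of [g] only says that [B >= 0], so that no progress comes from
    one component alone. Since [B >= 0], however, [gam] may be replaced by any
    lower bound. The inequality [g x - inf g >= |G|^2 / (2 M)], valid for an
    [M]-smooth [g], gives [gam >= 1/M] if [G] is not zero; if it is, then
    [B = 0] and the step-size does not matter (see [smooth_grad_le] and
    [sps_step_le]). The bound [V x - (2/M) B] is affine in [g], so it can be
    averaged over the components, and there the strong convexity of the average
    applies: the mean of [B] is at least [mu/2 * V x]. Hence one step contracts
    [V] in mean by the factor [1 - mu/M] ([mean_sps_step_le]), for every
    [M > 0] that is at least [maxL L].

    The current iterate is a function of the past draws, so it is independent of
    the next draw, and the one-step estimate iterates to the power [k]
    ([expectation_contraction]); this asks for a nonnegative factor. If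
    [maxL L < mu], some positive [M] with [maxL L <= M < mu] makes the factor
    negative, which forces [V] to vanish identically; both sides of the claim
    are then zero. This happens in dimension zero only, where Lipschitz
    constants may be arbitrarily small and even negative. *)

(** * Euclidean geometry *)

Definition dot {R : realType} {d : nat} (u v : 'rV[R]_d) : R :=
  \sum_(j < d) u 0 j * v 0 j.

Lemma enorm_ge0 (R : realType) d (u : 'rV[R]_d) : 0 <= enorm u.
Proof. exact: sqrtr_ge0. Qed.

Lemma enorm_sqr (R : realType) d (u : 'rV[R]_d) : enorm u ^+ 2 = dot u u.
Proof.
rewrite sqr_sqrtr; first by apply: eq_bigr => j _; rewrite expr2.
by apply: sumr_ge0 => j _; exact: sqr_ge0.
Qed.

Lemma enormZ_sqr (R : realType) d (a : R) (u : 'rV[R]_d) :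
  enorm (a *: u) ^+ 2 = a ^+ 2 * enorm u ^+ 2.
Proof.
by rewrite !enorm_sqr /dot mulr_sumr; apply: eq_bigr => j _; rewrite !mxE; ring.
Qed.

Lemma enormB_sqr (R : realType) d (u v : 'rV[R]_d) :
  enorm (u - v) ^+ 2 = enorm u ^+ 2 - 2 * dot u v + enorm v ^+ 2.
Proof.
rewrite !enorm_sqr /dot mulr_sumr -sumrB -big_split /=.
by apply: eq_bigr => j _; rewrite !mxE; ring.
Qed.

Lemma enormC (R : realType) d (u v : 'rV[R]_d) : enorm (u - v) = enorm (v - u).
Proof. by congr Num.sqrt; apply: eq_bigr => j _; rewrite !mxE -sqrrN opprB. Qed.

Lemma dotBl (R : realType) d (u v w : 'rV[R]_d) :
  dot (u - v) w = dot u w - dot v w.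
Proof.
by rewrite /dot -sumrB; apply: eq_bigr => j _; rewrite !mxE mulrBl.
Qed.

Lemma dotZr (R : realType) d (a : R) (u v : 'rV[R]_d) :
  dot u (a *: v) = a * dot u v.
Proof. by rewrite /dot mulr_sumr; apply: eq_bigr => j _; rewrite !mxE; ring. Qed.

(** Completing the square, [0 <= |u - c v|^2], replaces the Cauchy-Schwarz
    inequality here: it loses nothing when the norms are known to satisfy
    [|u| <= c |v|]. *)
Lemma dot_le_lipschitz (R : realType) d (c : R) (u v : 'rV[R]_d) :
  0 < c -> enorm u <= c * enorm v -> dot u v <= c * enorm v ^+ 2.
Proof.
move=> c0 uv.
have u2 : enorm u ^+ 2 <= c ^+ 2 * enorm v ^+ 2.
  by rewrite -exprMn ler_pXn2r// nnegrE ?enorm_ge0// mulr_ge0 ?enorm_ge0 ?ltW.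
have := sqr_ge0 (enorm (u - c *: v)).
rewrite enormB_sqr enormZ_sqr dotZr => h.
rewrite -(ler_pM2l c0); lra.
Qed.

(** * First-order inequalities *)

Lemma derive_dot (R : realType) d (g : 'rV[R]_d -> R) (x v : 'rV[R]_d) :
  differentiable g x -> 'D_v g x = dot (grad g x) v.
Proof.
move=> dg; rewrite deriveE// [in LHS](row_sum_delta v) linear_sum/=.
by apply: eq_bigr => j _; rewrite linearZ/= mxE deriveE// mulrC.
Qed.

(** Plain convexity is the case [mu = 0] of strong convexity, so that one
    first-order inequality serves both. *)
Lemma convexW (R : realType) d (g : 'rV[R]_d -> R) :
  convex g -> strongly_convex 0 g.
Proof.
move=> cg t x y /andP[t0 t1]; rewrite !mul0r subr0.
have := cg (Itv01 t0 t1) x y; rewrite !inE => /(_ I I).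
by rewrite convRE.
Qed.

(** Apply strong convexity to the points [x + h (y - x)] and divide by [h]: the
    difference quotients are at most [g y - g x - (1 - h) * mu/2 |x - y|^2].
    Let [h] decrease to zero. *)
Lemma strongly_convex_derive (R : realType) d (mu : R) (g : 'rV[R]_d -> R)
    (x y : 'rV[R]_d) :
  strongly_convex mu g -> derivable g x (y - x) ->
  'D_(y - x) g x <= g y - g x - mu / 2 * enorm (x - y) ^+ 2.
Proof.
move=> sg dg.
pose b := mu / 2 * enorm (x - y) ^+ 2.
have quot_cvg : h^-1 *: ((g \o shift x) (h *: (y - x)) - g x)
    @[h --> (0 : R)^'+] --> 'D_(y - x) g x by exact: cvg_dnbhs_at_right dg.
have bound_cvg : g y - g x - (1 - h) * b @[h --> (0 : R)^'+]
    --> g y - g x - b.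
  rewrite -[in X in _ --> X](mul1r b) -[in X in _ --> X](subr0 1).
  apply: cvgB; first exact: cvg_cst.
  apply: cvgM; last exact: cvg_cst.
  apply: cvgB; first exact: cvg_cst.
  exact: cvg_at_right_filter cvg_id.
apply: (ler_cvg_to quot_cvg bound_cvg).
near=> h.
have h0 : 0 < h by near: h; exact: nbhs_right_gt.
have h1 : h <= 1 by near: h; apply: nbhs_right_le.
have := sg h y x; rewrite h1 ltW// => /(_ isT).
have -> : h *: y + (1 - h) *: x = h *: (y - x) + x.
  by apply/rowP => j; rewrite !mxE; ring.
rewrite (enormC y) => le_sg.
rewrite /= -[X in X <= _]/(h^-1 * (g (h *: (y - x) + x) - g x)).
rewrite mulrC ler_pdivrMr// /b; lra.
Unshelve. all: by end_near. Qed.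

Lemma is_derive_line (R : realType) d (g : 'rV[R]_d -> R) (x v : 'rV[R]_d)
    (s : R) :
  differentiable g (x + s *: v) ->
  is_derive s (1 : R) (fun t : R => g (x + t *: v)) ('D_v g (x + s *: v)).
Proof.
move=> dg.
have E : (fun h : R => h^-1 *:
      (((fun t : R => g (x + t *: v)) \o shift s) (h *: (1 : R))
       - g (x + s *: v))) =
    (fun h => h^-1 *: ((g \o shift (x + s *: v)) (h *: v) - g (x + s *: v))).
  apply/funext => h /=; congr (_ *: (g _ - _)).
  by apply/rowP => j; rewrite !mxE /GRing.scale/=; ring.
split.
  by rewrite /derivable E; exact: diff_derivable.
by rewrite /derive E.
Qed.

(** The descent lemma. The difference [phi] between [g] and its quadratic
    majorant along the segment has derivative
      [<grad g (x + t v) - grad g x, v> - t L |v|^2 <= 0],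
    so the mean value theorem gives [phi 1 <= phi 0]. *)
Lemma smooth_le_quadratic (R : realType) d (L : R) (g : 'rV[R]_d -> R)
    (x v : 'rV[R]_d) :
  0 < L -> smooth L g ->
  g (x + v) <= g x + dot (grad g x) v + L / 2 * enorm v ^+ 2.
Proof.
move=> L0 [dg Lg].
pose D := dot (grad g x) v; pose N := enorm v ^+ 2.
pose phi (t : R) := g (x + t *: v) - (t * D + t ^+ 2 * (L / 2 * N)).
pose dphi (t : R) := 'D_v g (x + t *: v) - (D + t * (L * N)).
have dp (t : R) : is_derive t (1 : R) phi (dphi t).
  apply: is_deriveB; first exact: is_derive_line.
  apply: is_derive_eq.
  by rewrite /GRing.scale/=; field.
have cphi : {within `[0, 1], continuous phi}.
  have drv : {in `[0, 1], forall s : R, derivable phi s 1}.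
    by move=> s _; exact: (@ex_derive _ _ _ _ _ _ _ (dp s)).
  exact: derivable_within_continuous drv.
have dphiP (s : R) : s \in `]0, 1[ -> is_derive s (1 : R) phi (dphi s) by [].
have [t] := MVT ltr01 dphiP cphi.
rewrite in_itv/= => /andP[t0 _].
rewrite subr0 mulr1 /phi /dphi scale1r scale0r addr0 expr1n expr0n/=.
rewrite derive_dot// => e.
have := @dot_le_lipschitz _ _ (L * t) (grad g (x + t *: v) - grad g x) v.
rewrite mulr_gt0// => /(_ isT).
have -> : L * t * enorm v = L * enorm (x + t *: v - x).
  rewrite addrC addKr -mulrA; congr (_ * _).
  rewrite -[RHS]ger0_norm ?enorm_ge0// -sqrtr_sqr enormZ_sqr -exprMn sqrtr_sqr.
  by rewrite ger0_norm// mulr_ge0 ?enorm_ge0 ?ltW.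
move=> /(_ (Lg _ _)); rewrite dotBl -/D -/N; lra.
Qed.

(** The infimum lies below the value of [g] after the gradient step of length
    [L^-1], which minimizes the quadratic majorant. *)
Lemma smooth_grad_le (R : realType) d (L : R) (g : 'rV[R]_d -> R)
    (x : 'rV[R]_d) :
  0 < L -> smooth L g -> bounded_below g ->
  enorm (grad g x) ^+ 2 <= 2 * L * (g x - Defs.infimum g).
Proof.
move=> L0 Lg bg.
have inf_le : Defs.infimum g <= g (x + (- L^-1) *: grad g x).
  by apply: ge_inf => //; eexists.
have := smooth_le_quadratic x ((- L^-1) *: grad g x) L0 Lg.
rewrite enormZ_sqr dotZr -enorm_sqr => h.
have {}h : (2 * L)^-1 * enorm (grad g x) ^+ 2 <= g x - Defs.infimum g.
  have -> : (2 * L)^-1 * enorm (grad g x) ^+ 2 =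
     - (- L^-1 * enorm (grad g x) ^+ 2 +
        L / 2 * ((- L^-1) ^+ 2 * enorm (grad g x) ^+ 2)).
    by field; rewrite gt_eqF.
  lra.
by move: h; rewrite mulrC ler_pdivrMr ?mulr_gt0// mulrC.
Qed.

(** * One step of the method *)

(** The term in parentheses is [- B] of the introduction, a nonpositive number.
    It is written with a directional derivative because this expression is
    linear in [g], which makes averaging over the components possible. *)
Lemma sps_step_le (R : realType) d (L : R) (g : 'rV[R]_d -> R)
    (x xs : 'rV[R]_d) :
  0 < L -> convex g -> smooth L g -> bounded_below g -> Defs.infimum g = g xs ->
  enorm (x - sps_stepsize 2^-1 g x *: grad g x - xs) ^+ 2 <=
  enorm (x - xs) ^+ 2 + 2 / L * ('D_(xs - x) g x + g x - g xs).
Proof.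
move=> L0 cg Lg bg gxs.
have dgx : differentiable g x by case: Lg.
have := strongly_convex_derive (convexW cg)
  (@diff_derivable _ _ _ _ _ (xs - x) dgx).
rewrite !mul0r subr0 => B0.
have xs_le : g xs <= g x by rewrite -gxs; apply: ge_inf => //; eexists.
have G_le := smooth_grad_le x L0 Lg bg; rewrite gxs in G_le.
have -> : x - sps_stepsize 2^-1 g x *: grad g x - xs =
    (x - xs) - sps_stepsize 2^-1 g x *: grad g x by rewrite addrAC.
rewrite (enormB_sqr (x - xs)) enormZ_sqr dotZr.
have -> : dot (x - xs) (grad g x) = - 'D_(xs - x) g x.
  rewrite derive_dot// /dot -sumrN; apply: eq_bigr => j _; rewrite !mxE; ring.
move: B0; rewrite /sps_stepsize gxs.
set G := enorm (grad g x) ^+ 2 in G_le *; set p := 'D_(xs - x) g x => B0.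
have [G0|Gn0] := eqVneq G 0.
  (* The step-size is zero, and so is [B]; only [B <= 0] has to be checked. *)
  rewrite G0 !mulr0 invr0 mulr0 !mul0r mulr0 subr0 addr0 lerDl.
  apply: mulr_ge0; first by rewrite divr_ge0// ltW.
  suff -> : p = 0 by rewrite add0r subr_ge0.
  rewrite /p derive_dot//; apply: big1 => j _.
  move: G0; rewrite /G enorm_sqr /dot => /psumr_eq0P.
  have sq i : true -> 0 <= grad g x 0 i * grad g x 0 i.
    by rewrite -expr2 sqr_ge0.
  move=> /(_ sq j isT)/eqP; rewrite mulf_eq0 orbb => /eqP ->.
  by rewrite mul0r.
have Gp : 0 < G by rewrite lt_neqAle eq_sym Gn0 sqr_ge0.
set gam := (g x - g xs) / _.
have gamG : gam * G = 2 * (g x - g xs).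
  by rewrite /gam; field.
have gamL : L^-1 <= gam.
  by rewrite -(ler_pM2r Gp) gamG mulrC ler_pdivrMr//; lra.
(* Half of what is lost when [gam] is replaced by [L^-1]. *)
have : 0 <= (gam - L^-1) * (g xs - g x - p).
  by rewrite mulr_ge0 ?subr_ge0.
have -> : gam ^+ 2 * G = gam * (2 * (g x - g xs)) by rewrite -gamG; ring.
lra.
Qed.

(** [sigma2 f xs] is an average of nonnegative gaps [f i xs - inf (f i)]. *)
Lemma infimum_interpolation (R : realType) d n (f : 'I_n.+1 -> 'rV[R]_d -> R)
    (xs : 'rV[R]_d) :
  (forall i, bounded_below (f i)) -> sigma2 f xs = 0 ->
  forall i, Defs.infimum (f i) = f i xs.
Proof.
move=> bf /eqP; rewrite /sigma2 /average -mulrBr -sumrB mulf_eq0.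
rewrite invr_eq0 pnatr_eq0/= => /eqP /psumr_eq0P sum0 i.
have ge0 j : true -> 0 <= f j xs - Defs.infimum (f j).
  by move=> _; rewrite subr_ge0; apply: ge_inf; [exact: bf|exists xs].
by apply/eqP; rewrite eq_sym -subr_eq0; apply/eqP/sum0.
Qed.

Lemma is_derive_average (R : realType) d n (f : 'I_n.+1 -> 'rV[R]_d -> R)
    (x v : 'rV[R]_d) :
  (forall i, differentiable (f i) x) ->
  is_derive x v (average f) (n.+1%:R^-1 * \sum_(i < n.+1) 'D_v (f i) x).
Proof.
move=> df.
have -> : average f = n.+1%:R^-1 *: (\sum_(i < n.+1) f i).
  by apply/funext => y; rewrite /average fct_sumE.
apply: is_deriveZ; apply: is_derive_sum => i.
exact/derivableP/diff_derivable.
Qed.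

(** [L] is any positive common smoothness constant: the freedom to enlarge it is
    what settles the degenerate case of the final theorem. *)
Lemma mean_sps_step_le (R : realType) d n (f : 'I_n.+1 -> 'rV[R]_d -> R)
    (L mu : R) (xs x : 'rV[R]_d) :
  0 < L -> (forall i, convex (f i)) -> (forall i, smooth L (f i)) ->
  (forall i, bounded_below (f i)) -> strongly_convex mu (average f) ->
  (forall i, Defs.infimum (f i) = f i xs) ->
  n.+1%:R^-1 * \sum_(i < n.+1)
    enorm (x - sps_stepsize 2^-1 (f i) x *: grad (f i) x - xs) ^+ 2 <=
  (1 - mu / L) * enorm (x - xs) ^+ 2.
Proof.
move=> L0 cf Lf bf sf fxs.
have n0 : 1 + n%:R != 0 :> R by rewrite nat1r pnatr_eq0.
have [avg_derivable avgD] :=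
  @is_derive_average _ _ _ f x (xs - x) (fun i => (Lf i).1 x).
have /= avg_le := strongly_convex_derive sf avg_derivable.
set V := enorm (x - xs) ^+ 2 in avg_le *.
apply: (@le_trans _ _ (V + 2 / L * ('D_(xs - x) (average f) x
                                    + average f x - average f xs))).
  have -> : V + 2 / L * ('D_(xs - x) (average f) x
                         + average f x - average f xs) =
      n.+1%:R^-1 * \sum_(i < n.+1)
        (V + 2 / L * ('D_(xs - x) (f i) x + f i x - f i xs)).
    rewrite big_split/= sumr_const card_ord -mulr_sumr sumrB big_split/=.
    by rewrite avgD /average -mulr_natr; field; rewrite n0 gt_eqF.
  rewrite ler_pM2l ?invr_gt0 ?ltr0n//.
  apply: ler_sum => i _; exact: sps_step_le.
have -> : (1 - mu / L) * V = V + 2 / L * (- (mu / 2 * V)).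
  by field; rewrite gt_eqF.
by rewrite lerD2l ler_pM2l ?divr_gt0//; lra.
Qed.

(** * Iterations driven by independent uniform draws *)

Fixpoint random_iterate {I S : Type} (step : I -> S -> S) (x0 : S)
    (idx : nat -> I) (k : nat) : S :=
  if k is k'.+1 then step (idx k') (random_iterate step x0 idx k') else x0.

(** Every preimage is measurable, whatever the state space, because the iterate
    is a function of finitely many draws from a finite set. *)
Lemma measurable_random_iterate (disp : measure_display)
    (T : measurableType disp) (n : nat) (S : Type)
    (idx : nat -> T -> 'I_n.+1) (step : 'I_n.+1 -> S -> S) (x0 : S) :
  (forall k (A : set 'I_n.+1), measurable (idx k @^-1` A)) ->
  forall k (A : set S),
    measurable ((fun w => random_iterate step x0 (idx ^~ w) k) @^-1` A).
Proof.
move=> midx; elim=> [|k IH] A /=.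
  have [x0A|x0A] := pselect (A x0).
    by rewrite (_ : _ @^-1` _ = setT)//; apply/seteqP; split.
  by rewrite (_ : _ @^-1` _ = set0)//; apply/seteqP; split.
rewrite (_ : _ @^-1` _ = \bigcup_(i in [set: 'I_n.+1]) (idx k @^-1` [set i] `&`
  ((fun w => random_iterate step x0 (idx ^~ w) k) @^-1` (step i @^-1` A)))).
  by apply: fin_bigcup_measurable => // i _; exact: measurableI.
apply/seteqP; split=> [w /= Aw|w [i _] [/= <-]//].
by exists (idx k w).
Qed.

Lemma measurable_fun_random_iterate (R : realType) (disp : measure_display)
    (T : measurableType disp) (n : nat) (S : Type)
    (idx : nat -> T -> 'I_n.+1) (step : 'I_n.+1 -> S -> S) (x0 : S)
    (h : S -> \bar R) (k : nat) (D : set T) :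
  (forall j (A : set 'I_n.+1), measurable (idx j @^-1` A)) ->
  measurable_fun D (fun w => h (random_iterate step x0 (idx ^~ w) k) : \bar R).
Proof.
move=> midx mD Y _; apply: measurableI => //.
exact: (measurable_random_iterate step x0 midx k (h @^-1` Y)).
Qed.

(** A constraint on finitely many draws, all of them at times at least [k]. The
    [k]-th iterate depends on the draws at times below [k] only, so it is
    independent of these events. *)
Definition future_event {T I : Type} (idx : nat -> T -> I) (k : nat)
    (B : set T) : Prop :=
  exists (J : {fset nat}) (A : nat -> set I),
    (forall j, j \in J -> (k <= j)%N) /\
    B = \bigcap_(j in [set` J]) (idx j @^-1` A j).

Lemma future_eventT (T I : Type) (idx : nat -> T -> I) (k : nat) :
  future_event idx k setT.
Proof.
exists fset0, (fun=> setT); split => //.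
by rewrite set_fset0 bigcap_set0.
Qed.

Lemma measurable_future_event (disp : measure_display)
    (T : measurableType disp) (I : Type) (idx : nat -> T -> I) (k : nat)
    (B : set T) :
  (forall j (A : set I), measurable (idx j @^-1` A)) ->
  future_event idx k B -> measurable B.
Proof.
by move=> midx [J [A [_ ->]]]; apply: fin_bigcap_measurable.
Qed.

(** Fixing the draw at time [k] adds one index to the family of constraints,
    hence one factor in the product rule. *)
Lemma future_event_draw (R : realType) (disp : measure_display)
    (T : measurableType disp) (P : probability T R) (n : nat)
    (idx : nat -> T -> 'I_n.+1) (k : nat) (B : set T) (i : 'I_n.+1) :
  iid_uniform P idx -> future_event idx k.+1 B ->
  future_event idx k (B `&` idx k @^-1` [set i]) /\
  P (B `&` idx k @^-1` [set i]) = ((n.+1%:R^-1)%:E * P B)%E.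
Proof.
move=> [_ punif indep] [J [A [kJ ->]]].
have kNJ : k \notin J by apply/negP => /kJ; rewrite ltnn.
pose A' j := if j == k then [set i] else A j.
have AA' j : j \in J -> A' j = A j.
  by rewrite /A'; case: eqP => // -> /kJ; rewrite ltnn.
have -> : \bigcap_(j in [set` J]) (idx j @^-1` A j) `&` idx k @^-1` [set i] =
    \bigcap_(j in [set` (k |` J)%fset]) (idx j @^-1` A' j).
  rewrite bigcap_fsetU1 setIC {1}/A' eqxx; congr (_ `&` _).
  by apply: eq_bigcapr => j /= /AA' ->.
split.
  exists (k |` J)%fset, A'; split => // j.
  by rewrite !inE => /predU1P[->//|/kJ /ltnW].
rewrite !indep big_fsetU1//= {1}/A' eqxx punif; congr (_ * _)%E.
by apply: eq_big_seq => j /AA' ->.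
Qed.

Lemma integral_split_draw (R : realType) (disp : measure_display)
    (T : measurableType disp) (P : probability T R) (n : nat) (S : Type)
    (idx : nat -> T -> 'I_n.+1) (step : 'I_n.+1 -> S -> S) (x0 : S)
    (h : S -> \bar R) (k : nat) (B : set T) :
  (forall j (A : set 'I_n.+1), measurable (idx j @^-1` A)) ->
  (forall x, (0 <= h x)%E) -> measurable B ->
  (\int[P]_(w in B) h (random_iterate step x0 (idx ^~ w) k.+1) =
   \sum_(i < n.+1) \int[P]_(w in B `&` idx k @^-1` [set i])
     h (step i (random_iterate step x0 (idx ^~ w) k)))%E.
Proof.
move=> midx h0 mB.
pose F i := B `&` idx k @^-1` [set i].
have BE : B = \big[setU/set0]_(i <- index_enum 'I_n.+1) F i.
  rewrite -bigcup_seq; apply/seteqP; split=> [w Bw|w [i _] []//].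
  by exists (idx k w) => //=; rewrite mem_index_enum.
rewrite {1}BE ge0_integral_bigsetU//.
- apply: eq_bigr => i _; apply: eq_integral => w.
  by rewrite inE => -[_ /= <-].
- by move=> i; exact: measurableI.
- exact: index_enum_uniq.
- by move=> i j _ _ [w [[_ /= <-] [_ /= <-]]].
- exact: (@measurable_fun_random_iterate _ _ _ _ _ _ _ _ h k.+1).
Qed.

(** Independence of the [k]-th iterate from the future, by induction on [k]:
    splitting the integral over [B] according to the draw at time [k] turns
    the next iterate into the current one, with [h] composed with a step, and
    turns [B] into an event in the future of [k]. Both [h] and [B] change, so
    the induction is on the statement for all of them. *)
Lemma integral_future_event (R : realType) (disp : measure_display)
    (T : measurableType disp) (P : probability T R) (n : nat) (S : Type)
    (idx : nat -> T -> 'I_n.+1) (step : 'I_n.+1 -> S -> S) (x0 : S)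
    (h : S -> \bar R) (k : nat) (B : set T) :
  iid_uniform P idx -> (forall x, (0 <= h x)%E) -> future_event idx k B ->
  (\int[P]_(w in B) h (random_iterate step x0 (idx ^~ w) k) =
   P B * \int[P]_w h (random_iterate step x0 (idx ^~ w) k))%E.
Proof.
move=> iid; have [midx _ _] := iid.
elim: k h B => [|k IH] h B h0 fB; have mB := measurable_future_event midx fB.
  rewrite /= !integral_cst//.
  rewrite [X in (_ * (_ * X))%E](_ : _ = 1%E) ?mule1 1?muleC//.
  exact: probability_setT.
(* Used for [B] and for the whole space: the sum does not depend on [C]. *)
have draw C : future_event idx k.+1 C ->
    (\int[P]_(w in C) h (random_iterate step x0 (idx ^~ w) k.+1) =
     P C * \sum_(i < n.+1) (n.+1%:R^-1)%:E *
       \int[P]_w h (step i (random_iterate step x0 (idx ^~ w) k)))%E.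
  move=> fC; rewrite integral_split_draw//; last first.
    exact: measurable_future_event fC.
  rewrite ge0_sume_distrr; last first.
    move=> i _; rewrite mule_ge0 ?lee_fin ?invr_ge0 ?ler0n//.
    by apply: integral_ge0 => w _; exact: h0.
  apply: eq_bigr => i _.
  have [fCi PCi] := future_event_draw i iid fC.
  by rewrite (IH (h \o step i))//= PCi -muleA muleCA.
rewrite (draw B)// (draw setT); last exact: future_eventT.
by rewrite probability_setT mul1e.
Qed.

(** Since the [k]-th iterate is independent of the [k]-th draw, the event that
    the draw is [i] contributes its probability times an integral over the
    whole space. *)
Lemma expectation_random_iterateS (R : realType) (disp : measure_display)
    (T : measurableType disp) (P : probability T R) (n : nat) (S : Type)
    (idx : nat -> T -> 'I_n.+1) (step : 'I_n.+1 -> S -> S) (x0 : S)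
    (h : S -> \bar R) (k : nat) :
  iid_uniform P idx -> (forall x, (0 <= h x)%E) ->
  (\int[P]_w h (random_iterate step x0 (idx ^~ w) k.+1) =
   \int[P]_w ((n.+1%:R^-1)%:E *
     \sum_(i < n.+1) h (step i (random_iterate step x0 (idx ^~ w) k))))%E.
Proof.
move=> iid h0; have [midx _ _] := iid.
have mh i : measurable_fun setT
    (fun w => h (step i (random_iterate step x0 (idx ^~ w) k)) : \bar R).
  exact: (@measurable_fun_random_iterate _ _ _ _ _ _ _ _ (h \o step i)).
rewrite integral_split_draw// ge0_integralZl//; first last.
- by move=> w _; exact: sume_ge0.
- exact: emeasurable_sum.
rewrite ge0_integral_sum// ge0_sume_distrr; last first.
  by move=> i _; exact: integral_ge0.
apply: eq_bigr => i _.
have [fi Pi] := future_event_draw i iid (future_eventT idx k.+1).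
by rewrite (integral_future_event step x0 iid (h := h \o step i) _ fi)//= Pi
  [X in (_ * X * _)%E]probability_setT mule1.
Qed.

(** The mean contraction at each state integrates to one in expectation, and
    [0 <= rho] lets the bound at time [k] be multiplied by [rho]. *)
Lemma expectation_contraction (R : realType) (disp : measure_display)
    (T : measurableType disp) (P : probability T R) (n : nat) (S : Type)
    (idx : nat -> T -> 'I_n.+1) (step : 'I_n.+1 -> S -> S) (x0 : S)
    (V : S -> R) (rho : R) (k : nat) :
  iid_uniform P idx -> 0 <= rho -> (forall x, 0 <= V x) ->
  (forall x, n.+1%:R^-1 * \sum_(i < n.+1) V (step i x) <= rho * V x) ->
  (\int[P]_w (V (random_iterate step x0 (idx ^~ w) k))%:E <=
   (rho ^+ k * V x0)%:E)%E.
Proof.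
move=> iid rho0 V0 contr; have [midx _ _] := iid.
elim: k => [|k IH].
  rewrite /= integral_cst// [X in (_ * X)%E](_ : _ = 1%E) ?mule1 ?expr0 ?mul1r//.
  exact: probability_setT.
rewrite (@expectation_random_iterateS _ _ _ _ _ _ _ _ _ (EFin \o V))//=.
have mV g : measurable_fun setT
    (fun w => (g (random_iterate step x0 (idx ^~ w) k))%:E : \bar R).
  exact: (@measurable_fun_random_iterate _ _ _ _ _ _ _ _ (EFin \o g)).
apply: (@le_trans _ _
    (\int[P]_w (rho%:E * (V (random_iterate step x0 (idx ^~ w) k))%:E))%E).
  apply: ge0_le_integral => //.
  - move=> w _; rewrite mule_ge0 ?lee_fin ?invr_ge0//.
    by apply: sume_ge0 => i _; rewrite lee_fin.
  - under eq_fun do rewrite sumEFin -EFinM.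
    exact: (mV (fun x => n.+1%:R^-1 * \sum_(i < n.+1) V (step i x))).
  - exact: (mV (fun x => rho * V x)).
  - by move=> w _; rewrite sumEFin -!EFinM lee_fin.
rewrite ge0_integralZl//; last by move=> w _; rewrite lee_fin.
by rewrite exprS -mulrA EFinM lee_wpmul2l// lee_fin.
Qed.

(** * The convergence rate *)

Lemma smoothW (R : realType) d (L L' : R) (g : 'rV[R]_d -> R) :
  L <= L' -> smooth L g -> smooth L' g.
Proof.
move=> LL' [dg Lg]; split=> // x y.
by rewrite (le_trans (Lg x y))// ler_wpM2r ?enorm_ge0.
Qed.

Lemma le_maxL (R : realType) n (L : 'I_n.+1 -> R) (i : 'I_n.+1) : L i <= maxL L.
Proof. exact: le_bigmax. Qed.

Lemma sgd_spsE (R : realType) d n (c : R) (f : 'I_n.+1 -> 'rV[R]_d -> R)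
    (x0 : 'rV[R]_d) (idx : nat -> 'I_n.+1) (k : nat) :
  sgd_sps c f x0 idx k =
  random_iterate (fun i x => x - sps_stepsize c (f i) x *: grad (f i) x)
    x0 idx k.
Proof. by elim: k => //= k ->. Qed.

Unset Implicit Arguments.

Theorem corollary3p2 (R : realType) (d n : nat)
    (f : 'I_n.+1 -> 'rV[R]_d -> R) (L : 'I_n.+1 -> R) (mu : R)
    (xs x0 : 'rV[R]_d)
    (disp : measure_display) (T : measurableType disp) (P : probability T R)
    (idx : nat -> T -> 'I_n.+1)
    (f_convex : forall i, convex (f i))
    (f_smooth : forall i, smooth (L i) (f i))
    (f_bounded_below : forall i, bounded_below (f i))
    (mu_gt0 : 0 < mu)
    (avg_strongly_convex : strongly_convex mu (average f))
    (xs_min : minimizer (average f) xs)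
    (interpolation : sigma2 f xs = 0)
    (idx_iid : iid_uniform P idx) (k : nat) :
  ('E_P[(fun w : T =>
      enorm (sgd_sps 2^-1 f x0 (fun m => idx m w) k - xs) ^+ 2)%R]
   <= ((1 - mu / maxL L) ^+ k * enorm (x0 - xs) ^+ 2)%:E)%E.
Proof.
rewrite unlock; under eq_integral do rewrite sgd_spsE.
pose step i x := x - sps_stepsize 2^-1 (f i) x *: grad (f i) x.
pose V x := enorm (x - xs) ^+ 2.
have V0 x : 0 <= V x by exact: sqr_ge0.
have fxs := infimum_interpolation f_bounded_below interpolation.
have contr M x : 0 < M -> maxL L <= M ->
    n.+1%:R^-1 * \sum_(i < n.+1) V (step i x) <= (1 - mu / M) * V x.
  move=> M0 LM; apply: mean_sps_step_le => // i.
  exact: smoothW (le_trans (le_maxL L i) LM) (f_smooth i).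
have [muL|Lmu] := leP mu (maxL L).
  have L0 : 0 < maxL L by exact: lt_le_trans muL.
  apply: (@expectation_contraction _ _ _ _ _ _ _ step _ V) => //.
    by rewrite subr_ge0 ler_pdivrMr// mul1r.
  by move=> x; exact: contr.
(* A mean of squares is at most [(1 - mu / M) * V x], where the factor is
   negative for any positive [M] with [maxL L <= M < mu]. *)
have V_eq0 x : V x = 0.
  pose M := Num.max (maxL L) (mu / 2).
  have M0 : 0 < M by rewrite lt_max divr_gt0 ?orbT.
  have Mmu : M < mu by rewrite gt_max Lmu/=; lra.
  have mean0 : 0 <= n.+1%:R^-1 * \sum_(i < n.+1) V (step i x).
    by rewrite mulr_ge0 ?invr_ge0 ?ler0n// sumr_ge0.
  have := le_trans mean0 (contr M x M0 _); rewrite le_max lexx => /(_ isT).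
  rewrite nmulr_rge0 ?subr_lt0 ?ltr_pdivlMr ?mul1r// => Vle0.
  by apply/eqP; rewrite eq_le Vle0 V0.
have -> : (1 - mu / maxL L) ^+ k * enorm (x0 - xs) ^+ 2 = 0 ^+ k * V x0.
  by rewrite -/(V x0) V_eq0 !mulr0.
apply: (@expectation_contraction _ _ _ _ _ _ _ step _ V) => // x.
by under eq_bigr do rewrite V_eq0; rewrite big1_eq mulr0 mul0r.
Qed.
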